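(* Let $\mathcal{Q}$ be a small quantaloid. A tensored $\mathcal{Q}$-category $\mathbb{C}$ is cotensored if and only if, for every $f\colon X\to Y$ in $\mathcal{Q}$, the order-preserving map $-\otimes f\colon\mathbb{C}_Y\to\mathbb{C}_X$ is a left adjoint in $\mathrm{Cat}(\mathbf{2})$. In this case, its right adjoint is $\langle f,-\rangle\colon\mathbb{C}_X\to\mathbb{C}_Y$.
   Context: A quantaloid is a category whose hom-sets are complete lattices and whose composition preserves arbitrary suprema in each variable separately. For $f\colon X\to Y$ and $g\colon Z\to Y$, $[f,g]\colon Z\to X$ is the largest $h$ with $f\circ h\le g$; for $f\colon X\to Y$ and $g\colon X\to Z$, $\{f,g\}\colon Y\to Z$ is the largest $h$ with $h\circ f\le g$. A $\mathcal{Q}$-category $\mathbb{C}$ consists of a small set $\mathbb{C}_0$ of objects, a type $tx\in\mathcal{Q}_0$ for each $x\in\mathbb{C}_0$, and hom-arrows $\mathbb{C}(y,x)\colon tx\to ty$ with $1_{tx}\le\mathbb{C}(x,x)$ and $\mathbb{C}(z,y)\circ\mathbb{C}(y,x)\le\mathbb{C}(z,x)$. An order is a reflexive transitive relation; $x'\le x$ in $\mathbb{C}$ means $tx'=tx=X$ and $1_X\le\mathbb{C}(x',x)$; $\mathbb{C}_X$ is the ordered set of objects of $\mathbb{C}$ of type $X$. $\mathrm{Cat}(\mathbf{2})$ is the 2-category of orders and order-preserving maps; adjoints there are the usual adjoints (Galois connections), determined up to isomorphism. Tensors: for $f\colon X\to Y$ and $y\in\mathbb{C}_Y$, $y\otimes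 f$ is (if it exists) an object of type $X$, unique up to isomorphism, with $\mathbb{C}(y\otimes f,z)=[f,\mathbb{C}(y,z)]$ for all $z\in\mathbb{C}_0$. Cotensors: for $f\colon X\to Y$ and $x\in\mathbb{C}_X$, $\langle f,x\rangle$ is (if it exists) an object of type $Y$, unique up to isomorphism, with $\mathbb{C}(z,\langle f,x\rangle)=\{f,\mathbb{C}(z,x)\}$ for all $z\in\mathbb{C}_0$. $\mathbb{C}$ is (co)tensored if all (co)tensors exist. *)

(* Defs.v *)
From HB Require Import structures.
From mathcomp Require Import all_boot all_order.
From mathcomp Require Import boolp classical_sets.

Set Implicit Arguments.
Unset Strict Implicit.
Unset Printing Implicit Defensive.

Import Order.TTheory.
Local Open Scope order_scope.
Local Open Scope classical_set_scope.

Declare Scope quantaloid_scope.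
Delimit Scope quantaloid_scope with quantaloid.

(* A complete lattice is a partial order with suprema of arbitrary subsets.
   The supremum is unique, so carrying it as an operation is no restriction. *)
Record quantaloid (d : Order.disp_t) := Quantaloid {
  qobj :> Type;
  qhom : qobj -> qobj -> porderType d;
  qsup : forall X Y, set (qhom X Y) -> qhom X Y;
  qid : forall X, qhom X X;
  qcomp : forall X Y Z, qhom Y Z -> qhom X Y -> qhom X Z;
  qsup_isLub : forall X Y (A : set (qhom X Y)), isLub A (qsup A);
  qcomp1q : forall X Y (f : qhom X Y), qcomp (qid Y) f = f;
  qcompq1 : forall X Y (f : qhom X Y), qcomp f (qid X) = f;
  qcompA : forall W X Y Z (h : qhom Y Z) (g : qhom X Y) (f : qhom W X),
    qcomp h (qcomp g f) = qcomp (qcomp h g) f;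
  qcomp_supr : forall X Y Z (g : qhom Y Z) (A : set (qhom X Y)),
    qcomp g (qsup A) = qsup [set qcomp g f | f in A];
  qcomp_supl : forall X Y Z (A : set (qhom Y Z)) (f : qhom X Y),
    qcomp (qsup A) f = qsup [set qcomp g f | g in A];
}.
Arguments qid {d} q X.

Notation "g ∘ f" := (qcomp g f)
  (at level 40, left associativity) : quantaloid_scope.
Local Open Scope quantaloid_scope.

Section Residuals.
Context (d : Order.disp_t) (Q : quantaloid d).
Implicit Types X Y Z : Q.

(* [f, g], the largest h with f ∘ h <= g: see qliftP *)
Definition qlift X Y Z (f : qhom X Y) (g : qhom Z Y) : qhom Z X :=
  qsup [set h | f ∘ h <= g].

(* {f, g}, the largest h with h ∘ f <= g: see qextP *)
Definition qext X Y Z (f : qhom X Y) (g : qhom X Z) : qhom Y Z :=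
  qsup [set h | h ∘ f <= g].

Lemma qsup_ub X Y (A : set (qhom X Y)) : ubound A (qsup A).
Proof. exact: (qsup_isLub A).1. Qed.

Lemma qsup_le X Y (A : set (qhom X Y)) b : ubound A b -> qsup A <= b.
Proof. exact: (qsup_isLub A).2. Qed.

Lemma qsup_pair X Y (f g : qhom X Y) : f <= g -> qsup [set f; g] = g.
Proof.
move=> fg; apply/le_anti/andP; split; last by apply: qsup_ub; right.
by apply: qsup_le => _ [] ->.
Qed.

Lemma qcomp_le2l X Y Z (g : qhom Y Z) (f f' : qhom X Y) :
  f <= f' -> g ∘ f <= g ∘ f'.
Proof.
move=> /qsup_pair <-; rewrite qcomp_supr.
by apply: qsup_ub; exists f => //; left.
Qed.

Lemma qcomp_le2r X Y Z (g g' : qhom Y Z) (f : qhom X Y) :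
  g <= g' -> g ∘ f <= g' ∘ f.
Proof.
move=> /qsup_pair <-; rewrite qcomp_supl.
by apply: qsup_ub; exists g => //; left.
Qed.

Lemma qliftP X Y Z (f : qhom X Y) (g : qhom Z Y) (h : qhom Z X) :
  (h <= qlift f g) = (f ∘ h <= g).
Proof.
apply/idP/idP => [hle|]; last by move=> ?; apply: qsup_ub.
apply: (le_trans (qcomp_le2l f hle)); rewrite qcomp_supr.
by apply: qsup_le => _ [k /= ? <-].
Qed.

Lemma qextP X Y Z (f : qhom X Y) (g : qhom X Z) (h : qhom Y Z) :
  (h <= qext f g) = (h ∘ f <= g).
Proof.
apply/idP/idP => [hle|]; last by move=> ?; apply: qsup_ub.
apply: (le_trans (qcomp_le2r f hle)); rewrite qcomp_supl.
by apply: qsup_le => _ [k /= ? <-].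
Qed.

End Residuals.

Record qcat (d : Order.disp_t) (Q : quantaloid d) := QCat {
  cobj :> Type;
  ctyp : cobj -> Q;
  chom : forall y x : cobj, qhom (ctyp x) (ctyp y);
  chom_id : forall x, qid Q (ctyp x) <= chom x x;
  chom_comp : forall z y x, chom z y ∘ chom y x <= chom z x;
}.
Arguments ctyp {d Q q} x.
Arguments chom {d Q q} y x.

Record fiber (d : Order.disp_t) (Q : quantaloid d) (C : qcat Q) (X : Q) :=
  Fiber { fobj :> C; fobj_typ : ctyp fobj = X }.

Section Fibers.
Context (d : Order.disp_t) (Q : quantaloid d) (C : qcat Q).
Implicit Types X Y Z : Q.

Definition fib (z : C) : fiber C (ctyp z) := Fiber erefl.

(* The hom-arrow C(y, x), transported along the type equations tx = X and
   ty = Y. *)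
Definition fhom X Y (y : fiber C Y) (x : fiber C X) : qhom X Y :=
  match fobj_typ x in _ = X', fobj_typ y in _ = Y' return qhom X' Y' with
  | erefl, erefl => chom y x
  end.

Lemma fhom_fib (y x : C) : fhom (fib y) (fib x) = chom y x.
Proof. by []. Qed.

Lemma fhom_id X (x : fiber C X) : qid Q X <= fhom x x.
Proof. by case: x => x e; case: _ / e; exact: chom_id. Qed.

Lemma fhom_comp X Y Z (z : fiber C Z) (y : fiber C Y) (x : fiber C X) :
  fhom z y ∘ fhom y x <= fhom z x.
Proof.
case: x => x e; case: _ / e; case: y => y e; case: _ / e.
by case: z => z e; case: _ / e; exact: chom_comp.
Qed.

Definition fle X (x' x : fiber C X) : bool := qid Q X <= fhom x' x.

Lemma fle_refl X : reflexive (@fle X).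
Proof. by move=> x; exact: fhom_id. Qed.

Lemma fle_trans X : transitive (@fle X).
Proof.
move=> y x z xy yz; apply: le_trans (fhom_comp x y z).
by rewrite -[leLHS](qcomp1q (qid Q X)) (le_trans (qcomp_le2l _ yz)) ?qcomp_le2r.
Qed.

End Fibers.

HB.instance Definition _ d (Q : quantaloid d) (C : qcat Q) (X : Q) :=
  gen_eqMixin (fiber C X).
HB.instance Definition _ d (Q : quantaloid d) (C : qcat Q) (X : Q) :=
  gen_choiceMixin (fiber C X).
HB.instance Definition _ d (Q : quantaloid d) (C : qcat Q) (X : Q) :=
  Order.Le_isPreorder.Build d (fiber C X) (@fle_refl d Q C X) (@fle_trans d Q C X).

(* Cat(2) has the preorderTypes as objects and the {omorphism A -> B} as
   arrows. *)
Section Adjunctions.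
Context (d d' : Order.disp_t) (A : preorderType d) (B : preorderType d').

Definition adjoint (l : {omorphism A -> B}) (r : {omorphism B -> A}) : Prop :=
  forall a b, (l a <= b) = (a <= r b).

Definition is_left_adjoint (l : {omorphism A -> B}) : Prop :=
  exists r, adjoint l r.

End Adjunctions.

Section Tensors.
Context (d : Order.disp_t) (Q : quantaloid d) (C : qcat Q).
Implicit Types X Y Z : Q.

Definition is_tensor X Y (f : qhom X Y) (y : fiber C Y) (t : fiber C X) :=
  forall z : C, fhom t (fib z) = qlift f (fhom y (fib z)).

Definition is_cotensor X Y (f : qhom X Y) (x : fiber C X) (t : fiber C Y) :=
  forall z : C, fhom (fib z) t = qext f (fhom (fib z) x).

Definition tensored : Prop :=
  forall X Y (f : qhom X Y) (y : fiber C Y), exists t, is_tensor f y t.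

Definition cotensored : Prop :=
  forall X Y (f : qhom X Y) (x : fiber C X), exists t, is_cotensor f x t.

(* (Co)tensors are only determined up to isomorphism, so the operations
   y ⊗ f and <f, x> depend on a choice of (co)tensors. *)
Record tensoring := Tensoring {
  tens : forall X Y, qhom X Y -> fiber C Y -> fiber C X;
  tensP : forall X Y (f : qhom X Y) y, is_tensor f y (tens f y);
}.

Record cotensoring := Cotensoring {
  cotens : forall X Y, qhom X Y -> fiber C X -> fiber C Y;
  cotensP : forall X Y (f : qhom X Y) x, is_cotensor f x (cotens f x);
}.

Lemma tensoredP : tensored <-> inhabited tensoring.
Proof.
split=> [H|[T] X Y f y]; last by exists (tens T f y); exact: tensP.
split; exists (fun X Y f y => sval (cid (H X Y f y))) => X Y f y.
exact: svalP (cid (H X Y f y)).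
Qed.

Lemma cotensoredP : cotensored <-> inhabited cotensoring.
Proof.
split=> [H|[S] X Y f x]; last by exists (cotens S f x); exact: cotensP.
split; exists (fun X Y f x => sval (cid (H X Y f x))) => X Y f x.
exact: svalP (cid (H X Y f x)).
Qed.

Lemma is_tensorE X Y (f : qhom X Y) (y : fiber C Y) (t : fiber C X) :
  is_tensor f y t -> forall Z (z : fiber C Z), fhom t z = qlift f (fhom y z).
Proof. by move=> ty Z [z e]; case: _ / e; exact: ty. Qed.

Lemma is_cotensorE X Y (f : qhom X Y) (x : fiber C X) (t : fiber C Y) :
  is_cotensor f x t -> forall Z (z : fiber C Z), fhom z t = qext f (fhom z x).
Proof. by move=> tx Z [z e]; case: _ / e; exact: tx. Qed.

Lemma tens_homo (T : tensoring) X Y (f : qhom X Y) :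
  {homo tens T f : y y' / y <= y'}.
Proof.
move=> y y' yy'; rewrite /Order.le/= /fle (is_tensorE (tensP T f y)) qliftP qcompq1.
have : f <= fhom y' (tens T f y').
  by rewrite -[leLHS]qcompq1 -qliftP -(is_tensorE (tensP T f y')) fhom_id.
move=> /(qcomp_le2l (fhom y y')) fle; apply: le_trans (fhom_comp _ y' _).
by apply: le_trans fle; rewrite -[leLHS]qcomp1q qcomp_le2r.
Qed.

Lemma cotens_homo (S : cotensoring) X Y (f : qhom X Y) :
  {homo cotens S f : x x' / x <= x'}.
Proof.
move=> x x' xx'; rewrite /Order.le/= /fle (is_cotensorE (cotensP S f x')).
rewrite qextP qcomp1q.
have fx : f <= fhom (cotens S f x) x.
  by rewrite -[leLHS]qcomp1q -qextP -(is_cotensorE (cotensP S f x)) fhom_id.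
apply: le_trans (fhom_comp _ x _); rewrite -[leLHS]qcompq1.
by rewrite (le_trans (qcomp_le2r _ fx)) ?qcomp_le2l.
Qed.

HB.instance Definition _ (T : tensoring) X Y (f : qhom X Y) :=
  Order.isOrderMorphism.Build d (fiber C Y) d (fiber C X) (tens T f)
    (@tens_homo T X Y f).

HB.instance Definition _ (S : cotensoring) X Y (f : qhom X Y) :=
  Order.isOrderMorphism.Build d (fiber C X) d (fiber C Y) (cotens S f)
    (@cotens_homo S X Y f).

End Tensors.

(* Main.v *)
Require Import Defs.
From mathcomp Require Import all_boot all_order.

(** Both [y ⊗ f <= x] and [y <= <f, x>] say that [f <= C(y, x)]: the universal
    property of either object turns the inequality into [1 <= [f, C(y, x)]]
    or [1 <= {f, C(y, x)}], and residuation removes the identity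
    ([tensor_le], [le_cotensor]).  Hence cotensoring with [f] is right adjoint
    to tensoring with [f] as soon as both exist.

    The converse is less immediate, because a right adjoint [r] of [- ⊗ f] only
    sees the order on objects of one type, whereas a cotensor is a condition on
    hom-arrows from objects of every type.  Tensors with all the other arrows
    bridge the gap.  For [z] of type [Z] and [h : Y -> Z],
      [h <= C(z, r x)]  iff  [z ⊗ h <= r x]  iff  [(z ⊗ h) ⊗ f <= x]
                        iff  [f <= C(z ⊗ h, x) = [h, C(z, x)]]
                        iff  [h ∘ f <= C(z, x)]  iff  [h <= {f, C(z, x)}],
    and an element of a partial order is determined by the elements below it,
    so [C(z, r x) = {f, C(z, x)}] ([right_adjoint_cotensor]). *)

Import Order.TTheory.
Local Open Scope order_scope.
Local Open Scope quantaloid_scope.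

Section TensorsAndCotensors.
Local Set Implicit Arguments.
Local Unset Strict Implicit.
Context (d : Order.disp_t) (Q : quantaloid d) (C : qcat Q).
Implicit Types X Y : Q.

Lemma tensor_le X Y (f : qhom X Y) (y : fiber C Y) (t x : fiber C X) :
  is_tensor f y t -> (t <= x) = (f <= fhom y x).
Proof.
by move=> ty; rewrite /Order.le /= /fle (is_tensorE ty) qliftP qcompq1.
Qed.

Lemma le_cotensor X Y (f : qhom X Y) (x : fiber C X) (t y : fiber C Y) :
  is_cotensor f x t -> (y <= t) = (f <= fhom y x).
Proof.
by move=> tx; rewrite /Order.le /= /fle (is_cotensorE tx) qextP qcomp1q.
Qed.

Lemma tens_cotens_adjoint (T : tensoring C) (S : cotensoring C) X Y
    (f : qhom X Y) :
  adjoint (tens T f) (cotens S f).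
Proof.
by move=> y x; rewrite (tensor_le _ (tensP T f y)) (le_cotensor _ (cotensP S f x)).
Qed.

(** Although only one arrow [f] occurs in the statement, the proof tensors
    with every arrow [h] into the type of [z]: this is how the order on the
    objects of type [Y] recovers the hom-arrow [C(z, r x)]. *)
Lemma right_adjoint_cotensor (T : tensoring C) X Y (f : qhom X Y)
    (r : {omorphism fiber C X -> fiber C Y}) (x : fiber C X) :
  adjoint (tens T f) r -> is_cotensor f x (r x).
Proof.
move=> adj z.
have below h : (h <= fhom (fib z) (r x)) = (h <= qext f (fhom (fib z) x)).
  have zh := tensP T h (fib z).
  rewrite -(tensor_le _ zh) -adj (tensor_le _ (tensP T f _)).
  by rewrite (is_tensorE zh) qliftP qextP.
by apply/le_anti; rewrite -below lexx below lexx.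
Qed.

End TensorsAndCotensors.

Theorem proposition3p6 (d : Order.disp_t) (Q : quantaloid d) (C : qcat Q)
    (hC : tensored C) (T : tensoring C) :
  (cotensored C <->
     forall (X Y : Q) (f : qhom X Y), is_left_adjoint (tens T f)) /\
  (cotensored C ->
     forall (S : cotensoring C) (X Y : Q) (f : qhom X Y),
       adjoint (tens T f) (cotens S f)).
Proof.
split; last by move=> _ S X Y f; exact: tens_cotens_adjoint.
split=> [/cotensoredP[S] X Y f | left_adj X Y f x].
  by exists (cotens S f); exact: tens_cotens_adjoint.
have [r adj] := left_adj X Y f.
by exists (r x); exact: right_adjoint_cotensor adj.
Qed.
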